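(* Let $G$ be a graph of maximum degree at most $3$. Then $R(G)\geq \left(\frac{1}{\sqrt{3}}+\frac{1}{3}\right)\alpha'(G)$, and equality holds if and only if the graph obtained from $G$ by removing all isolated vertices is of the form $H\circ K_1$ for some $2$-regular graph $H$.
   Context: All graphs are finite and simple. For a graph $G$, the Randić index is $R(G)=\sum_{uv\in E(G)} \frac{1}{\sqrt{d(u)d(v)}}$, where $d(\cdot)$ denotes degree in $G$. $\alpha'(G)$ denotes the matching number of $G$. For a graph $H$, the corona product $H\circ K_1$ is the graph obtained from $H$ by adding, for each vertex $v$ of $H$, a new vertex adjacent only to $v$ (i.e. attaching one pendant edge at every vertex of $H$). *)

(* Defs.v *)
From HB Require Import structures.
From mathcomp Require Import all_boot all_order all_algebra.
From mathcomp Require Import reals.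

Set Implicit Arguments.
Unset Strict Implicit.
Unset Printing Implicit Defensive.

Import GRing.Theory Num.Theory.
Local Open Scope ring_scope.

(* The null graph (no vertices) is allowed. *)
Record sgraph := SGraph {
  vertex :> finType;
  adj : rel vertex;
  adj_sym : symmetric adj;
  adj_irrefl : irreflexive adj }.

Definition degree (G : sgraph) (u : G) : nat := #|[set v : G | adj u v]|.

Definition max_degree (G : sgraph) : nat := (\max_(u : G) degree u)%N.

Definition edges (G : sgraph) : {set {set G}} :=
  [set [set p.1; p.2] | p : G * G & adj p.1 p.2].

(* An edge A = {u, v} has u != v, so the product over A is d(u) d(v). *)
Definition randic (R : realType) (G : sgraph) : R :=
  \sum_(A in edges G) (Num.sqrt (\prod_(u in A) degree u)%N%:R)^-1.

Definition matching (G : sgraph) (M : {set {set G}}) : bool :=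
  (M \subset edges G) && trivIset M.

Definition matching_number (G : sgraph) : nat :=
  (\max_(M : {set {set G}} | matching M) #|M|)%N.

Definition regular (k : nat) (G : sgraph) : Prop :=
  forall u : G, degree u = k.

Definition isomorphic (G H : sgraph) : Prop :=
  exists2 f : G -> H, bijective f & forall u v : G, adj (f u) (f v) = adj u v.

Section Induced.
Variables (G : sgraph) (P : pred G).

Definition induced_adj (u v : {x : G | P x}) : bool := adj (val u) (val v).

Fact induced_adj_sym : symmetric induced_adj.
Proof. by move=> u v; apply: adj_sym. Qed.

Fact induced_adj_irrefl : irreflexive induced_adj.
Proof. by move=> u; apply: adj_irrefl. Qed.

Definition induced : sgraph := SGraph induced_adj_sym induced_adj_irrefl.
End Induced.

Definition remove_isolated (G : sgraph) : sgraph :=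
  induced (fun u : G => (0 < degree u)%N).

Section Corona.
Variable H : sgraph.

(* H o K_1: inl v is the vertex v of H, inr v the pendant vertex at v. *)
Definition corona_adj (x y : (H + H)%type) : bool :=
  match x, y with
  | inl u, inl v => adj u v
  | inl u, inr v => u == v
  | inr u, inl v => u == v
  | inr _, inr _ => false
  end.

Fact corona_adj_sym : symmetric corona_adj.
Proof. by case=> u [] v //=; [apply: adj_sym | apply: eq_sym..]. Qed.

Fact corona_adj_irrefl : irreflexive corona_adj.
Proof. by case=> u //=; apply: adj_irrefl. Qed.

Definition corona : sgraph := SGraph corona_adj_sym corona_adj_irrefl.
End Corona.

(* Main.v *)
(** Give each end of an edge the share s(d) determined by its degree d, with
    s(2) = 2/9 and s(1) = s(3) = 1/6. When all degrees are at most 3, an edge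
    with end degrees a, b has weight w(a,b) = 1/sqrt(ab) >= s(a) + s(b), with
    equality only for a = b = 3. For a matching M, let the edges outside M hand
    their shares to their ends: an edge of M then accumulates
    w(a,b) + (a-1) s(a) + (b-1) s(b) >= 1/sqrt 3 + 1/3, with equality only for
    {a,b} = {1,3}, and the vertices missed by M keep a nonnegative surplus
    d s(d). Summing up, R(G) >= (1/sqrt 3 + 1/3) |M|. In the case of equality
    every nonisolated vertex lies on an edge of M, the edges of M join a leaf to
    a cubic vertex and the other edges join cubic vertices, which says that G is
    a corona of a 2-regular graph plus isolated vertices. Conversely the pendant
    edges of such a corona are a matching attaining equality, and
    R(G) = (1/sqrt 3 + 1/3) |M| together with the inequality for a maximum
    matching forces M to be maximum. *)

Require Import Defs.
From mathcomp Require Import all_boot all_order all_algebra.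
From mathcomp Require Import reals.
From mathcomp Require Import lra.

Set Implicit Arguments.
Unset Strict Implicit.
Unset Printing Implicit Defensive.

Import Order.TTheory GRing.Theory Num.Theory.
Local Open Scope ring_scope.

(** * Numerical inequalities for edge weights and shares *)

Section Numeric.
Variable R : realType.
Implicit Types a b : nat.

(** The argument stands for the product of the two end degrees of an edge. *)
Definition edge_weight (n : nat) : R := (Num.sqrt n%:R)^-1.

Definition share (d : nat) : R := if d == 2%N then 2 / 9 else 6^-1.

Lemma invsqrt_lt (x y : R) : 0 <= x -> 0 < y -> 1 < y * x ^+ 2 -> (Num.sqrt y)^-1 < x.
Proof.
move=> x0 y0 h; rewrite -(@ltr_pXn2r _ 2) ?nnegrE ?invr_ge0 ?sqrtr_ge0 //.
by rewrite exprVn (sqr_sqrtr (ltW y0)) -[y^-1]mul1r ltr_pdivrMr // mulrC.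
Qed.

Lemma invsqrt_gt (x y : R) : 0 <= x -> 0 < y -> y * x ^+ 2 < 1 -> x < (Num.sqrt y)^-1.
Proof.
move=> x0 y0 h; rewrite -(@ltr_pXn2r _ 2) ?nnegrE ?invr_ge0 ?sqrtr_ge0 //.
by rewrite exprVn (sqr_sqrtr (ltW y0)) -[y^-1]mul1r ltr_pdivlMr // mulrC.
Qed.

Lemma edge_weight1 : edge_weight 1 = 1.
Proof. by rewrite /edge_weight sqrtr1 invr1. Qed.

Lemma edge_weight_sqr n : edge_weight (n ^ 2) = n%:R^-1.
Proof. by rewrite /edge_weight natrX sqrtr_sqr normr_nat. Qed.

(** The rational bounds from here on are sharp enough for linear arithmetic. The narrow cases are a
    matched edge with end degrees 1, 2, where 7/10 + 2/9 > 29/50 + 1/3, and an unmatched one with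
    end degrees 2, 3, where 2/5 > 2/9 + 1/6. *)
Lemma edge_weight2_gt : 7 / 10 < edge_weight 2.
Proof. by apply: invsqrt_gt; lra. Qed.

Lemma edge_weight3_gt : 1 / 2 < edge_weight 3.
Proof. by apply: invsqrt_gt; lra. Qed.

Lemma edge_weight3_lt : edge_weight 3 < 29 / 50.
Proof. by apply: invsqrt_lt; lra. Qed.

Lemma edge_weight6_gt : 2 / 5 < edge_weight 6.
Proof. by apply: invsqrt_gt; lra. Qed.

Ltac degree_cases a b :=
  case: a => [|[|[|[|a]]]] //; case: b => [|[|[|[|b]]]] // _ _;
  have := edge_weight1; have := edge_weight_sqr 2; have := edge_weight_sqr 3;
  have := edge_weight2_gt; have := edge_weight3_gt;
  have := edge_weight3_lt; have := edge_weight6_gt;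
  rewrite ?mul1n ?muln1 /share /=.

Lemma share_le_weight a b : (0 < a <= 3)%N -> (0 < b <= 3)%N ->
  share a + share b <= edge_weight (a * b) ?= iff (a * b == 9)%N.
Proof.
degree_cases a b => *; apply/leifP => //=; lra.
Qed.

Lemma matched_weight_ge a b : (0 < a <= 3)%N -> (0 < b <= 3)%N ->
  edge_weight 3 + 3^-1 <=
    edge_weight (a * b) + (a.-1%:R * share a + b.-1%:R * share b)
  ?= iff (a * b == 3)%N.
Proof.
degree_cases a b => *; apply/leifP => //=; lra.
Qed.

End Numeric.

(** * Edges, matchings and the discharging argument *)

Section Graph.
Variable G : sgraph.
Implicit Types (u v x y : G) (A : {set G}) (M : {set {set G}}).

Lemma adj_neq u v : adj u v -> u != v.
Proof. by apply: contraTneq => ->; rewrite adj_irrefl. Qed.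

Lemma edgesP A : reflect (exists u v, adj u v /\ A = [set u; v]) (A \in edges G).
Proof.
apply: (iffP imsetP) => [[[u v]] | [u [v [uv ->]]]].
  by rewrite inE /= => uv ->; exists u, v.
by exists (u, v); rewrite ?inE.
Qed.

Lemma set2_inj u v x : u != v -> [set u; v] = [set u; x] -> v = x.
Proof.
move=> uv /setP/(_ v); rewrite !inE eqxx orbT eq_sym (negbTE uv) /=.
by move/esym/eqP.
Qed.

Lemma mem_edges u v : ([set u; v] \in edges G) = adj u v.
Proof.
apply/edgesP/idP => [[x [y [xy E]]] | uv]; last by exists u, v.
have := set21 u v; rewrite E !inE => /orP[]/eqP Eu; subst u.
  by rewrite -(set2_inj (adj_neq xy) (esym E)).
rewrite adj_sym in xy; rewrite [RHS]setUC in E.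
by rewrite -(set2_inj (adj_neq xy) (esym E)).
Qed.

Lemma card_edges_at u : #|[set A in edges G | u \in A]| = degree u.
Proof.
have -> : [set A in edges G | u \in A] = (fun v => [set u; v]) @: [set v | adj u v].
  apply/setP=> A; rewrite inE; apply/andP/imsetP => [[/edgesP[x [y [xy ->]]]] | [v]].
    rewrite !inE => /orP[]/eqP->; first by exists y; rewrite ?inE.
    by exists x; rewrite ?inE 1?adj_sym // setUC.
  by rewrite inE => uv ->; rewrite mem_edges set21.
rewrite card_in_imset // => v w; rewrite !inE => uv _.
exact: set2_inj (adj_neq uv).
Qed.

Lemma degree_gt0 u v : adj u v -> (0 < degree u)%N.
Proof. by move=> uv; rewrite card_gt0; apply/set0Pn; exists v; rewrite inE. Qed.

Lemma matching_edge M A : matching M -> A \in M -> A \in edges G.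
Proof. by case/andP=> /subsetP sM _; apply: sM. Qed.

Lemma matching_uniq M u v x :
  matching M -> [set u; v] \in M -> [set u; x] \in M -> v = x.
Proof.
move=> mM uvM uxM; have uv : adj u v by rewrite -mem_edges (matching_edge mM).
apply: (set2_inj (adj_neq uv)); case/andP: mM => _ /trivIsetP tM.
have [//|ne] := eqVneq [set u; v] [set u; x].
by have /pred0P/(_ u) := tM _ _ uvM uxM ne; rewrite /= !set21.
Qed.

Lemma coverP_matching M u :
  matching M -> reflect (exists v, [set u; v] \in M) (u \in cover M).
Proof.
move=> mM; apply: (iffP bigcupP) => [[A AM] | [v uvM]]; last first.
  by exists [set u; v]; rewrite ?set21.
have /edgesP[x [y [_ EA]]] := matching_edge mM AM; subst A.
rewrite !inE => /orP[]/eqP->; first by exists y.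
by exists x; rewrite setUC.
Qed.

(* [9 = 3 * 3] and [3 = 1 * 3]: the end degrees of the edges outside, inside M. *)
Definition tight M : bool :=
  [&& [forall (A | A \in edges G :\: M), \prod_(u in A) degree u == 9]%N,
      [forall (A | A \in M), \prod_(u in A) degree u == 3]%N
    & [forall (u | u \notin cover M), degree u == 0%N]].

Lemma tightP M : M \subset edges G ->
  reflect [/\ forall u v, adj u v -> [set u; v] \notin M -> (degree u * degree v = 9)%N,
              forall u v, adj u v -> [set u; v] \in M -> (degree u * degree v = 3)%N
            & forall u, u \notin cover M -> degree u = 0%N]
          (tight M).
Proof.
move=> sM; have prod_edge u v : adj u v ->
    (\prod_(x in [set u; v]) degree x = degree u * degree v)%N.
  by move/adj_neq=> uv; rewrite big_setU1 ?inE //= big_set1.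
apply: (iffP and3P) => [[/forall_inP h9 /forall_inP h3 /forall_inP h0] | [h9 h3 h0]].
  split=> [u v uv uvM | u v uv uvM | u uM]; last exact/eqP/h0.
    by rewrite -(prod_edge _ _ uv); apply/eqP/h9; rewrite inE uvM mem_edges.
  by rewrite -(prod_edge _ _ uv); apply/eqP/h3.
split; apply/forall_inP; [move=> A | move=> A AM | by move=> u uM; apply/eqP/h0].
  rewrite inE => /andP[AM /edgesP[u [v [uv EA]]]]; subst A.
  by rewrite prod_edge // h9.
have /edgesP[u [v [uv EA]]] := subsetP sM A AM; subst A.
by rewrite prod_edge // h3.
Qed.

Hypothesis maxdeg3 : (max_degree G <= 3)%N.

Lemma degree_le3 u : (degree u <= 3)%N.
Proof. exact: leq_trans (leq_bigmax u) maxdeg3. Qed.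

Lemma adj_degree u v : adj u v -> (0 < degree u <= 3)%N.
Proof. by move=> uv; rewrite degree_le3 (degree_gt0 uv). Qed.

Variable R : realType.

(** The discharging as an exact identity. A vertex of degree d collects its share from each incident
    edge outside [M]: d - 1 of them if [M] covers it, all d otherwise. *)
Lemma randic_share M : matching M ->
  randic R G =
    \sum_(A in edges G :\: M)
       (edge_weight R (\prod_(u in A) degree u) - \sum_(u in A) share R (degree u))
  + (\sum_(A in M) (edge_weight R (\prod_(u in A) degree u)
       + \sum_(u in A) (degree u).-1%:R * share R (degree u))
  + \sum_(u | u \notin cover M) (degree u)%:R * share R (degree u)).
Proof.
move=> mM; have /andP[sM tM] := mM.
(* Double counting: over all edges, [u] receives its share [degree u] times. The vertices are then
   split by [cover M], which the disjoint edges of [M] partition. *)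
have split_shares : \sum_(A in edges G) \sum_(u in A) share R (degree u)
    = \sum_(A in M) \sum_(u in A) (degree u)%:R * share R (degree u)
    + \sum_(u | u \notin cover M) (degree u)%:R * share R (degree u).
  rewrite -(big_trivIset _ tM) /=.
  rewrite -[RHS](bigID (mem (cover M)) xpredT) /=.
  under [LHS]eq_bigr do rewrite big_mkcond.
  rewrite exchange_big; apply: eq_bigr => u _.
  rewrite -big_mkcondr /= big_const -/(iter _ _ _) iter_addr_0.
  by rewrite -card_edges_at mulr_natl; congr (_ *+ _); apply: eq_card => A; rewrite !inE.
rewrite sumrB; set S1 := \sum_(A in _ :\: _) _; set S2 := \sum_(A in _ :\: _) _.
have -> : randic R G = \sum_(A in M) edge_weight R (\prod_(u in A) degree u) + S1.
  by rewrite /randic (big_setID M) /= (setIidPr sM).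
move: split_shares; rewrite (big_setID M) /= (setIidPr sM) -/S2 => E.
rewrite big_split /=.
(* The double count included the edges of [M]; taking out their own shares lowers the multiplicity
   by one, and ends of edges have positive degree, so [.-1] does not truncate. *)
have -> : \sum_(A in M) \sum_(u in A) (degree u).-1%:R * share R (degree u)
  = \sum_(A in M) \sum_(u in A) (degree u)%:R * share R (degree u)
   - \sum_(A in M) \sum_(u in A) share R (degree u).
  rewrite -sumrB; apply: eq_bigr => A /(matching_edge mM)/edgesP[x [y [xy ->]]].
  rewrite -sumrB; apply: eq_bigr => u; rewrite !inE => uxy.
  have d0 : (0 < degree u)%N.
    by case/orP: uxy => /eqP->; [|rewrite adj_sym in xy]; exact: degree_gt0 xy.
  by case: (degree u) d0 => // d _; rewrite -natr1 mulrDl mul1r addrK.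
lra.
Qed.

(** The three sums of [randic_share] are bounded term by term. The [?= iff] conditions of the terms
    accumulate, and their conjunction is exactly [tight M]. *)
Lemma randic_ge_matching M : matching M ->
  ((Num.sqrt 3)^-1 + 3^-1) * #|M|%:R <= randic R G ?= iff tight M.
Proof.
move=> mM; rewrite (randic_share mM).
(* Zero sums pad the bound to the shape of [randic_share], so that both sides can be compared
   summand by summand. *)
have -> : ((Num.sqrt 3)^-1 + 3^-1) * #|M|%:R =
   \sum_(A in edges G :\: M) 0 + (\sum_(A in M) ((Num.sqrt 3)^-1 + 3^-1 : R)
   + \sum_(u | u \notin cover M) 0).
  by rewrite !big1_eq add0r addr0 sumr_const mulr_natr.
apply: leifD; last apply: leifD; apply: leif_sum.
- move=> A; rewrite inE => /andP[_ /edgesP[u [v [uv ->]]]].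
  have uv' := adj_neq uv; rewrite !big_setU1 ?inE //= !big_set1.
  rewrite leifBRL add0r.
  apply: share_le_weight; apply: adj_degree; first exact: uv.
  by rewrite adj_sym; exact: uv.
- move=> A /(matching_edge mM)/edgesP[u [v [uv ->]]].
  have uv' := adj_neq uv; rewrite !big_setU1 ?inE //= !big_set1.
  apply: matched_weight_ge; apply: adj_degree; first exact: uv.
  by rewrite adj_sym; exact: uv.
- move=> u _; apply/leifP; case: eqP => [->|/eqP]; first by rewrite mul0r.
  rewrite -lt0n => d0; rewrite mulr_gt0 ?ltr0n // /share; case: ifP => _; lra.
Qed.
End Graph.

(** * Degrees in induced subgraphs, under isomorphism and in coronas *)

Local Open Scope nat_scope.

Lemma degree_induced (G : sgraph) (P : pred G) (u : induced P) :
  degree u = #|[set v : G | adj (val u) v && P v]|.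
Proof.
rewrite /degree -(card_imset _ val_inj); apply: eq_card => v.
rewrite inE; apply/imsetP/andP => [[w uw ->] | [uv Pv]].
  by rewrite inE in uw; split; [exact: uw | exact: (valP w)].
by exists (exist _ v Pv : {x | P x}); rewrite ?inE.
Qed.

Lemma degree_remove_isolated (G : sgraph) (u : remove_isolated G) :
  degree u = degree (val u).
Proof.
rewrite degree_induced; apply: eq_card => v; rewrite !inE.
case uv: (adj _ v) => //=; rewrite adj_sym in uv.
exact: degree_gt0 uv.
Qed.

Lemma degree_isomorphism (G H : sgraph) (f : G -> H) :
  bijective f -> (forall u v, adj (f u) (f v) = adj u v) ->
  forall u, degree (f u) = degree u.
Proof.
move=> bf fadj u; rewrite /degree -(card_imset _ (bij_inj bf)).
case: (bf) => g fK gK; apply: eq_card => y; rewrite inE; apply/idP/imsetP.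
  by move=> uy; exists (g y); rewrite ?gK // inE -fadj gK.
by case=> v; rewrite inE => uv ->; rewrite fadj.
Qed.

Lemma degree_corona_core (H : sgraph) (v : H) :
  degree (inl v : corona H) = (degree v).+1.
Proof.
rewrite /degree.
have -> : [set x : corona H | adj (inl v : corona H) x] =
    (inr v : corona H) |: [set (inl w : corona H) | w in [set w | adj v w]].
  apply/setP=> -[w|w]; rewrite !inE /=.
    by rewrite mem_imset ?inE // => ? ? [].
  by rewrite [X in _ || X](_ : _ = false) ?orbF 1?eq_sym //; apply/imsetP => -[].
rewrite cardsU1 card_imset; last by move=> ? ? [].
by case: imsetP => // -[].
Qed.

Lemma degree_corona_pendant (H : sgraph) (v : H) :
  degree (inr v : corona H) = 1.
Proof.
rewrite /degree; apply: (etrans _ (cards1 (inl v : corona H))).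
apply: eq_card => -[w|w].
  by rewrite !inE eq_sym.
by rewrite !inE.
Qed.

Lemma isomorphic_sym (G H : sgraph) : isomorphic G H -> isomorphic H G.
Proof.
case=> f [g fK gK] fadj; exists g; first by exists f.
by move=> u v; rewrite -fadj !gK.
Qed.

Lemma inj_surj_bij (A B : choiceType) (f : A -> B) :
  injective f -> (forall y, exists x, f x == y) -> bijective f.
Proof.
move=> fI fS; have gK y := eqP (xchooseP (fS y)).
by exists (fun y => xchoose (fS y)) => // x; apply: fI.
Qed.

Lemma mul_le3_eq3 (a b : nat) : (a <= 3)%N -> (b <= 3)%N -> (a * b = 3)%N ->
  a = 3 /\ b = 1 \/ a = 1 /\ b = 3.
Proof.
by case: a => [|[|[|[|a]]]] //; case: b => [|[|[|[|b]]]] // _ _; auto.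
Qed.

Lemma mul_le3_eq9 (a b : nat) : (a <= 3)%N -> (b <= 3)%N -> (a * b = 9)%N ->
  a = 3.
Proof. by case: a => [|[|[|[|a]]]] //; case: b => [|[|[|[|b]]]]. Qed.

(** * A tight matching exhibits the corona structure *)

Section TightToCorona.
Variables (G : sgraph) (M : {set {set G}}).
Hypotheses (maxdeg3 : (max_degree G <= 3)%N) (mM : matching M) (tM : tight M).

(** The partner of [v] in [M]. For cubic [v] the default is never taken, since tightness makes [M]
    cover every nonisolated vertex. *)
Definition pendant (v : G) : G := odflt v [pick y | [set v; y] \in M].

(** The witness for the 2-regular graph [H]. *)
Definition cubic_core : sgraph := induced (fun u : G => degree u == 3).

Lemma matched_adj u v : [set u; v] \in M -> adj u v.
Proof. by move/(matching_edge mM); rewrite mem_edges. Qed.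

Lemma matched_degrees u v : [set u; v] \in M ->
  degree u = 3 /\ degree v = 1 \/ degree u = 1 /\ degree v = 3.
Proof.
move=> uvM; apply: mul_le3_eq3; rewrite ?degree_le3 //.
case/andP: mM => sM _; have /(tightP sM)[_ h _] := tM.
by apply: h; rewrite ?matched_adj.
Qed.

Lemma unmatched_degree u v : adj u v -> [set u; v] \notin M -> degree u = 3.
Proof.
move=> uv uvM; apply: (@mul_le3_eq9 _ (degree v)); rewrite ?degree_le3 //.
case/andP: mM => sM _; have /(tightP sM)[h _ _] := tM.
exact: h.
Qed.

Lemma degree_gt0_matched u : (0 < degree u)%N -> exists v, [set u; v] \in M.
Proof.
move=> du; apply/(coverP_matching _ mM); apply: contraLR du.
case/andP: mM => sM _; have /(tightP sM)[_ _ h] := tM.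
by move/h->.
Qed.

Lemma pendantP v : degree v = 3 -> [set v; pendant v] \in M.
Proof.
move=> dv; rewrite /pendant; case: pickP => [//|none].
have [|y vyM] := @degree_gt0_matched v; first by rewrite dv.
by have := none y; rewrite vyM.
Qed.

Lemma degree_pendant v : degree v = 3 -> degree (pendant v) = 1.
Proof.
by move=> dv; case: (matched_degrees (pendantP dv)) => -[] //; rewrite dv.
Qed.

(** Edges outside [M] join cubic vertices, so the edge from [v] to [y] lies in [M], which has only
    one edge at [v]. *)
Lemma pendant_nbr v y : degree v = 3 -> adj v y -> degree y != 3 -> y = pendant v.
Proof.
move=> dv vy dy; apply: (matching_uniq mM) (pendantP dv).
apply: contraNT dy => vyM; apply/eqP/(@unmatched_degree y v).
  by rewrite adj_sym.
by rewrite setUC.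
Qed.

Lemma cubic_core_regular : regular 2 cubic_core.
Proof.
move=> u; rewrite degree_induced; have /eqP dv := valP u.
set v : G := val u in dv *; apply: succn_inj; rewrite -[in RHS]dv.
(* Of the three neighbours of [v], exactly one, the pendant, is not cubic; the other two remain in
   the core. *)
have -> : degree v = #|pendant v |: [set w | adj v w && (degree w == 3)]|.
  apply: eq_card => w; rewrite !inE.
  apply/idP/orP => [vw | [/eqP-> | /andP[]//]]; last exact: matched_adj (pendantP dv).
  case: (eqVneq (degree w) 3) => dw; first by right; rewrite vw.
  by left; apply/eqP; exact: pendant_nbr.
by rewrite cardsU1 !inE degree_pendant // andbF.
Qed.

Definition corona_vertex (x : corona cubic_core) : G :=
  match x with inl v => val v | inr v => pendant (val v) end.

Lemma degree_corona_vertex x :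
  degree (corona_vertex x) = if x is inl _ then 3 else 1.
Proof.
by case: x => v /=; have /eqP dv := valP v; [exact: dv | exact: degree_pendant].
Qed.

Lemma corona_vertex_gt0 x : (0 < degree (corona_vertex x))%N.
Proof. by rewrite degree_corona_vertex; case: x. Qed.

Lemma pendant_inj u v : degree u = 3 -> degree v = 3 -> pendant u = pendant v -> u = v.
Proof.
move=> du dv E; have := pendantP du; have := pendantP dv.
by rewrite -E ![[set _; pendant u]]setUC => vM uM; apply: (matching_uniq mM uM).
Qed.

(** Degrees 3 and 1 tell core vertices from pendants; within each kind, [val] and [pendant] are
    injective. *)
Lemma corona_vertex_inj : injective corona_vertex.
Proof.
move=> x y E; have := degree_corona_vertex x; rewrite E degree_corona_vertex.
case: x y E => [u|u] [v|v] //= E _; congr (_ _); apply: val_inj => //.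
by apply: pendant_inj E; apply/eqP; [exact: (valP u) | exact: (valP v)].
Qed.

Lemma corona_vertex_adj x y : adj (corona_vertex x) (corona_vertex y) = adj x y.
Proof.
have pend_adj (u v : cubic_core) : adj (val u) (pendant (val v)) = (u == v).
  have /eqP du := valP u; have /eqP dv := valP v.
  apply/idP/eqP => [uv | ->]; last exact: matched_adj (pendantP dv).
  apply: val_inj; apply: pendant_inj => //; apply/esym/pendant_nbr => //.
  by rewrite degree_pendant.
case: x y => [u|u] [v|v] //=; first by rewrite pend_adj.
  by rewrite adj_sym pend_adj eq_sym.
(* Two pendants are never adjacent: every edge, in [M] or not, has a cubic end. *)
apply/negP => uv; have /eqP du := valP u; have /eqP dv := valP v.
have uvM : [set pendant (val u); pendant (val v)] \in M.
  by apply: contraT => /(unmatched_degree uv); rewrite degree_pendant.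
by case: (matched_degrees uvM); rewrite !degree_pendant // => -[].
Qed.

(** The edge of [M] at [u] has one cubic end: either [u] itself, or the vertex whose pendant is
    [u]. *)
Lemma corona_vertex_surj u : (0 < degree u)%N -> exists x, corona_vertex x = u.
Proof.
case/degree_gt0_matched=> v uvM.
case: (matched_degrees uvM) => -[/eqP du /eqP dv].
  by exists (inl (exist _ u du)).
exists (inr (exist _ v dv)); apply: (matching_uniq mM) (_ : [set v; u] \in M).
  exact: pendantP (eqP dv).
by rewrite setUC.
Qed.

Lemma tight_corona :
  exists H : sgraph, regular 2 H /\ isomorphic (remove_isolated G) (corona H).
Proof.
exists cubic_core; split; first exact: cubic_core_regular.
apply: isomorphic_sym.
exists (fun x => exist _ (corona_vertex x) (corona_vertex_gt0 x) : remove_isolated G).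
  apply: inj_surj_bij => [x y [] | [u du]]; first exact: corona_vertex_inj.
  have [x xu] := corona_vertex_surj du.
  by exists x; apply/eqP/val_inj.
by move=> x y; apply: corona_vertex_adj.
Qed.

End TightToCorona.

(** * The pendant edges of a corona form a tight matching *)

Lemma corona_tight (G H : sgraph) :
  regular 2 H -> isomorphic (remove_isolated G) (corona H) ->
  exists2 M : {set {set G}}, matching M & tight M.
Proof.
move=> regH [f bf fadj]; have fdeg := degree_isomorphism bf fadj.
(* [e] embeds the corona into [G]. It preserves degrees, as deleting isolated vertices changes no
   remaining degree, and its image contains all nonisolated vertices. *)
case: bf => g fK gK; pose e x : G := val (g x).
have eI : injective e by move=> x y /val_inj/(can_inj gK).
have eadj x y : adj (e x) (e y) = adj x y by rewrite -[in RHS](gK x) -[in RHS](gK y) fadj.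
have edeg x : degree (e x) = degree x.
  by rewrite -degree_remove_isolated -fdeg gK.
have eS u : (0 < degree u)%N -> exists x, u = e x.
  by move=> du; exists (f (exist _ u du)); rewrite /e fK.
pose M := [set [set e (inl v); e (inr v)] | v : H].
have sM : M \subset edges G.
  by apply/subsetP => _ /imsetP[v _ ->]; rewrite mem_edges eadj /= eqxx.
exists M.
  rewrite /matching sM; apply/trivIsetP => _ _ /imsetP[v _ ->] /imsetP[w _ ->] ne.
  have vw : v != w by apply: contraNneq ne => ->.
  apply/pred0P => u; apply/negP; rewrite /= !inE.
  by case/andP=> /orP[]/eqP-> /orP[]/eqP/eI // [] /eqP; apply/negP.
(* Each edge of [M] contains a pendant vertex [e (inr w)]. *)
have notM a b : [set e (inl a); e (inl b)] \notin M.
  apply/imsetP => -[w _ E]; have := set22 (e (inl w)) (e (inr w)).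
  by rewrite -E !inE => /orP[]/eqP/eI.
have inM a : [set e (inl a); e (inr a)] \in M by apply: imset_f.
have d3 a : degree (e (inl a)) = 3 by rewrite edeg degree_corona_core regH.
have d1 a : degree (e (inr a)) = 1 by rewrite edeg degree_corona_pendant.
apply/(tightP sM); split=> [u v uv | u v uv | u uM].
- have [x ux] := eS u (degree_gt0 uv); have vu := uv; rewrite adj_sym in vu.
  have [y vy] := eS v (degree_gt0 vu); subst u v; move: uv; rewrite eadj.
  case: x y {vu} => [a|a] [b|b] //=; rewrite ?d3 // => /eqP->; rewrite ?inM //.
  by rewrite setUC inM.
- have [x ux] := eS u (degree_gt0 uv); have vu := uv; rewrite adj_sym in vu.
  have [y vy] := eS v (degree_gt0 vu); subst u v; move: uv; rewrite eadj.
  case: x y {vu} => [a|a] [b|b] //=; rewrite ?d3 ?d1 //.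
  by rewrite (negPf (notM _ _)).
(* Contrapositive: a nonisolated vertex is some [e x], hence lies on the pendant edge belonging to
   [x]. *)
apply/eqP; rewrite -leqn0 leqNgt; apply: contra uM => /eS[x ->].
apply/bigcupP; case: x => a; exists [set e (inl a); e (inr a)];
  by rewrite ?inM ?set21 ?set22.
Qed.

(** * Maximum matchings and the conclusion *)

Lemma max_matching (G : sgraph) :
  exists2 M : {set {set G}}, matching M & matching_number G = #|M|.
Proof.
have m0 : matching (set0 : {set {set G}}).
  rewrite /matching sub0set; apply/trivIsetP => A B; by rewrite inE.
(* The maximum is attained because the family of matchings is nonempty: it contains [set0]. *)
have [|M mM E] := @eq_bigmax_cond _ [pred M : {set {set G}} | matching M] (fun M => #|M|).
  by apply/card_gt0P; exists set0.
by exists M.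
Qed.

Local Open Scope ring_scope.

Theorem theorem3p1 (R : realType) (G : sgraph) (hG : (max_degree G <= 3)%N) :
  ((Num.sqrt 3)^-1 + 3^-1) * (matching_number G)%:R <= randic R G /\
  (randic R G = ((Num.sqrt 3)^-1 + 3^-1) * (matching_number G)%:R <->
   exists H : sgraph, regular 2 H /\ isomorphic (remove_isolated G) (corona H)).
Proof.
have [M mM EM] := max_matching G; have [leR eqR] := randic_ge_matching hG R mM.
rewrite EM; split=> //; split=> [E | [H [regH isoH]]].
  by apply: (tight_corona hG mM); rewrite -eqR E.
have [N mN tN] := corona_tight regH isoH.
have [_] := randic_ge_matching hG R mN; rewrite tN => /eqP eqN.
(* [N] is not yet known to be maximum, but its tightness makes R(G) equal to the constant times
   [#|N|], and [#|N|] is at most [matching_number G]; this is the missing upper bound. *)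
apply/eqP; rewrite eq_le leR andbT -eqN.
rewrite ler_wpM2l ?addr_ge0 ?invr_ge0 ?sqrtr_ge0 // ler_nat -EM.
exact: (leq_bigmax_cond (F := fun N : {set {set G}} => #|N|) _ mN).
Qed.
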